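(* Let $Y=m(X)+\sigma(X)\varepsilon$, where $X$ and $\varepsilon$ are independent real random variables, $\mathbb{E}[\varepsilon]=0$, $\mathrm{Var}[\varepsilon]=1$, and $m:\mathbb{R}\to\mathbb{R}$, $\sigma:\mathbb{R}\to[0,\infty)$ are functions. Let $J:[0,1]\to\mathbb{R}$ be a weight function and let $$r(x;J)=\int_{[0,1]}J(\tau)\,Q_{Y\vert x}(\tau)\,\mathrm{d}\tau .$$ Let $W:\mathbb{R}\to\mathbb{R}$ be a function satisfying $\mathbb{E}[W(X)\sigma(X)]>0$. Then: (i) if $\int_{[0,1]}J(\tau)\,\mathrm{d}\tau=1$, then $$\mathbb{E}[W(X)\sigma(X)]\int_{[0,1]}J(\tau)F_\varepsilon^{-1}(\tau)\,\mathrm{d}\tau=\mathbb{E}\big[W(X)\,(r(X;J)-Y)\big];$$ (ii) if $\int_{[0,1]}J(\tau)\,\mathrm{d}\tau=0$, then $$\mathbb{E}\big[W(X)\,r^2(X;J)\big]=\Big(\int_{[0,1]}J(\tau)F_\varepsilon^{-1}(\tau)\,\mathrm{d}\tau\Big)^2\,\mathbb{E}\big[W(X)\,(Y^2-m^2(X))\big].$$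
   Context: $F_\varepsilon$ is the distribution function of $\varepsilon$ and $F_\varepsilon^{-1}(\tau)=\inf\{t:F_\varepsilon(t)\ge\tau\}$ is its quantile function. $Q_{Y\vert x}(\tau)=\inf\{t:\mathbb{P}(Y\le t\mid X=x)\ge\tau\}$ is the conditional $\tau$-quantile of $Y$ given $X=x$; in this model $Q_{Y\vert x}(\tau)=m(x)+\sigma(x)F_\varepsilon^{-1}(\tau)$. The functions $m,\sigma,W,J$ are measurable, $J$ and $JF_\varepsilon^{-1}$ are integrable on $[0,1]$, and $W(X)m(X)$, $W(X)\sigma(X)$, $W(X)m^2(X)$, $W(X)\sigma^2(X)$ are integrable, so that all the integrals and expectations are well defined. $r^2(X;J)$ means $(r(X;J))^2$. *)

(* Defs.v *)
From HB Require Import structures.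
From mathcomp Require Import all_boot all_order all_algebra.
From mathcomp Require Import all_classical all_reals all_analysis.

Set Implicit Arguments.
Unset Strict Implicit.
Unset Printing Implicit Defensive.

Import Order.TTheory GRing.Theory Num.Theory.
Import numFieldNormedType.Exports.

Local Open Scope classical_set_scope.
Local Open Scope ring_scope.

Definition independent_RV d (T : measurableType d) (R : realType)
    (P : probability T R) (X Y : {RV P >-> R}) : Prop :=
  forall A B : set R, measurable A -> measurable B ->
    P (X @^-1` A `&` Y @^-1` B) = (P (X @^-1` A) * P (Y @^-1` B))%E.

(* For a distribution function F and 0 < tau < 1 the set is nonempty and
   bounded below, so this is the usual quantile. At tau = 0 and tau = 1, where
   the infimum may be infinite, the real-valued [inf] may return 0 instead;
   these two points are Lebesgue-null and quantiles are only integrated. *)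
Definition quantile (R : realType) (F : R -> \bar R) (tau : R) : R :=
  inf [set t | (tau%:E <= F t)%E].

(* kappa is a version of the (regular) conditional distribution of Y given X:
   kappa x B is P(Y \in B | X = x). It is determined for almost every x with
   respect to the law of X. *)
Definition is_cond_distribution d (T : measurableType d) (R : realType)
    (P : probability T R) (X Y : {RV P >-> R}) (kappa : R.-pker R ~> R) : Prop :=
  forall A B : set R, measurable A -> measurable B ->
    P (X @^-1` A `&` Y @^-1` B)
      = (\int[distribution P X]_(x in A) kappa x B)%E.

Definition cond_quantile (R : realType) (kappa : R.-pker R ~> R) (x tau : R) :
    R :=
  quantile (fun t => kappa x `]-oo, t]%classic) tau.

(* r(x; J) *)
Definition weighted_cond_quantile (R : realType) (kappa : R.-pker R ~> R)
    (J : R -> R) (x : R) : R :=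
  \int[lebesgue_measure]_(tau in `[0, 1]) (J tau * cond_quantile kappa x tau).

(* Main.v *)
(* For almost every x with respect to the law of X, the measure kappa x is the
   law of m x + sigma x * eps: the two families have the same integrals over
   Borel sets, hence agree a.e. on each ray ]-oo, q] with q rational, hence on
   all rays by right-continuity. Quantiles commute with nondecreasing affine
   maps, so r(x; J) = m x * \int J + sigma x * \int (J * quantile (cdf eps)) for
   such x. Both claims then follow by expanding Y and using
   E[f(X) g(eps)] = E[f(X)] E[g(eps)] with E[eps] = 0 and E[eps^2] = 1; in (ii)
   the cross term W m sigma is integrable since |m sigma| <= m^2 + sigma^2. *)

Require Import Defs.
From HB Require Import structures.
From mathcomp Require Import all_boot all_order all_algebra.
From mathcomp Require Import all_classical all_reals all_analysis.
From mathcomp Require Import measurable_realfun ring lra.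

Set Implicit Arguments.
Unset Strict Implicit.
Unset Printing Implicit Defensive.

Import Order.TTheory GRing.Theory Num.Theory.
Import numFieldNormedType.Exports.

Local Open Scope classical_set_scope.
Local Open Scope ring_scope.

(** * Integrals of functions that may fail to be measurable *)

Section integral_off_null.
Import HBNNSimple.

(* Neither f nor g is assumed measurable: x |-> r(x; J) and the quantile
   functions are only controlled off a null set. *)
Lemma integral_eq_off_null d (T : measurableType d) (R : realType)
    (mu : {measure set T -> \bar R}) (D N : set T) (f g : T -> \bar R) :
  measurable N -> mu N = 0%E -> {in D `\` N, f =1 g} ->
  (\int[mu]_(x in D) f x = \int[mu]_(x in D) g x)%E.
Proof.
move=> mN N0 fg.
have ge0_le (h k : T -> \bar R) : (forall x, 0 <= h x)%E ->
    (forall x, 0 <= k x)%E -> {in ~` N, h =1 k} ->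
    (\int[mu]_x h x <= \int[mu]_x k x)%E.
  move=> h0 k0 hk; rewrite [leLHS]ge0_integralTE//.
  apply: ge_ereal_sup => _ [u uh <-]; rewrite -integralT_nnsfun.
  (* The simple function [u] below [h] is cut to 0 on [N]. The result [v] has the same integral as
     [u] and lies below [k]: off [N] because [h] and [k] agree there, on [N] because [k] is
     nonnegative. *)
  have [v vE] : exists v : {nnsfun T >-> R}, u \_ (~` N) =1 v.
    by exists (proj_nnsfun u (measurableC mN)) => x; rewrite -mrestrict.
  rewrite (ae_eq_integral (fun x => (v x)%:E))//=; first last.
  - exists N; split => // x /= /not_implyP[_ xv]; apply: contrapT => xN.
    by apply: xv; rewrite -vE patchE mem_set.
  - exact/measurable_EFinP/measurable_funP.
  - exact/measurable_EFinP/measurable_funP.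
  rewrite ge0_integralTE; last by move=> x; rewrite lee_fin.
  rewrite ge0_integralTE//.
  apply: ge_ereal_sup => _ [w wv <-].
  apply: ereal_sup_ubound; exists w => // x; apply: le_trans (wv x) _.
  by rewrite -vE patchE; case: ifPn => // xN; rewrite -hk.
have ge0_eq (h k : T -> \bar R) : (forall x, 0 <= h x)%E ->
    (forall x, 0 <= k x)%E -> {in ~` N, h =1 k} ->
    (\int[mu]_x h x = \int[mu]_x k x)%E.
  by move=> h0 k0 hk; apply/eqP; rewrite eq_le !ge0_le// => x /hk.
rewrite integral_mkcond [RHS]integral_mkcond integralE [RHS]integralE.
have fgD : {in ~` N, f \_ D =1 g \_ D}.
  move=> x /set_mem xN; rewrite !patchE; case: ifPn => // /set_mem xD.
  by rewrite fg// mem_set.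
by congr (_ - _)%E; apply: ge0_eq => // x /fgD;
  rewrite ?(funepos.unlock, funeneg.unlock) => ->.
Qed.

End integral_off_null.

(** * Distribution functions and quantiles *)

Lemma cdf_eq_rat d d' (T : measurableType d) (T' : measurableType d')
    (R : realType) (P : probability T R) (Q : probability T' R)
    (X : {RV P >-> R}) (Y : {RV Q >-> R}) :
  (forall q : rat, cdf X (ratr q) = cdf Y (ratr q)) -> cdf X =1 cdf Y.
Proof.
move=> XY t.
suff le_cdf (d1 d2 : measure_display) (T1 : measurableType d1)
    (T2 : measurableType d2) (P1 : probability T1 R) (P2 : probability T2 R)
    (X1 : {RV P1 >-> R}) (X2 : {RV P2 >-> R}) :
    (forall q : rat, cdf X1 (ratr q) = cdf X2 (ratr q)) ->
    (cdf X1 t <= cdf X2 t)%E.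
  by apply/eqP; rewrite eq_le !le_cdf.
(* For a rational [q] with t < q < s, monotonicity gives [cdf X1 t <= cdf X1 q = cdf X2 q <= cdf X2
   s]; then [s] tends to [t] from the right. *)
move=> X12; have := @cdf_right_continuous _ _ _ _ X2 t.
apply: cvge_ge; near=> s.
have ts : t < s by near: s; exact: nbhs_right_gt.
have [q] := rat_in_itvoo ts; rewrite in_itv/= => /andP[tq qs].
apply: (@le_trans _ _ (cdf X1 (ratr q))).
  exact/cdf_nondecreasing/ltW.
by rewrite X12; exact/cdf_nondecreasing/ltW.
Unshelve. all: by end_near. Qed.

(** The increasing bijection t |-> a + s * t carries the superlevel set [A] onto [B]. The assumption
    [has_inf] excludes the default value 0 of [inf], which this map would not respect. *)
Lemma quantile_affine (R : realType) (F : R -> \bar R) (a s tau : R) :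
  0 < s -> has_inf [set t | (tau%:E <= F t)%E] ->
  quantile (fun t => F ((t - a) / s)) tau = a + s * quantile F tau.
Proof.
move=> s0 [[t0 t0F] [l lF]]; rewrite /quantile.
set A := [set t | (tau%:E <= F t)%E]; set B := [set t | _].
have AB t : A t -> B (a + s * t).
  by rewrite /B/= addrC addKr mulrC mulKf ?gt_eqF.
have lB : lbound B (a + s * inf A).
  move=> t Bt; rewrite addrC -lerBrDr mulrC -ler_pdivlMr//.
  by apply: ge_inf => //; exists l.
apply/eqP; rewrite eq_le; apply/andP; split; last first.
  by apply: lb_le_inf => //; exists (a + s * t0); exact: AB.
rewrite addrC -lerBlDr mulrC -ler_pdivrMr//.
apply: lb_le_inf; first by exists t0.
move=> t /AB Bt; rewrite ler_pdivrMr// lerBlDr mulrC addrC.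
by apply: ge_inf => //; exists (a + s * inf A).
Qed.

(** The level [tau] lies strictly between the limits of the distribution function. If the set were
    empty, the limit 1 at +oo would be at most [tau]; if it had no lower bound, monotonicity would
    put [cdf X] above [tau] everywhere, against the limit 0 at -oo. *)
Lemma has_inf_cdf d (T : measurableType d) (R : realType)
    (P : probability T R) (X : {RV P >-> R}) (tau : R) :
  0 < tau -> tau < 1 -> has_inf [set t | (tau%:E <= cdf X t)%E].
Proof.
move=> tau0 tau1; split.
  apply: contrapT => /set0P/negP/negPn/eqP S0.
  suff : (1%:E <= tau%:E :> \bar R)%E by rewrite lee_fin leNgt tau1.
  apply: cvge_le (cvg_cdfy1 X); apply: nearW => t; rewrite leNgt.
  apply/negP => tX; have : [set t | (tau%:E <= cdf X t)%E] t by exact: ltW.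
  by rewrite S0.
apply: contrapT => unbounded.
suff : (tau%:E <= 0%:E :> \bar R)%E by rewrite lee_fin leNgt tau0.
apply: cvge_ge (cvg_cdfNy0 X); apply: nearW => t; rewrite leNgt.
apply/negP => tX; apply: unbounded; exists t => u /= uX.
rewrite leNgt; apply/negP => ut.
have := le_lt_trans (le_trans uX (cdf_nondecreasing X (ltW ut))) tX.
by rewrite ltxx.
Qed.

Lemma quantile_cdf_affine d (T : measurableType d) (R : realType)
    (P : probability T R) (X : {RV P >-> R}) (a s tau : R) :
  0 <= s -> 0 < tau -> tau < 1 ->
  quantile (fun t => P [set w | a + s * X w <= t]) tau
  = a + s * quantile (cdf X) tau.
Proof.
rewrite le_eqVlt => /predU1P[<-|s0] tau0 tau1.
  (* Scale 0 gives the point mass at [a], whose superlevel set at [tau] is the ray from [a]. *)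
  rewrite mul0r addr0 /quantile.
  suff -> : [set t | (tau%:E <= P [set w | (a + 0 * X w <= t)%R])%E]
      = `[a, +oo[%classic by rewrite inf_itv.
  apply/seteqP; split => t /=; rewrite in_itv/= andbT.
    apply: contraTT; rewrite -ltNge => ta.
    rewrite (_ : [set w | _] = set0) ?measure0 -?ltNge ?lte_fin//.
    by apply/seteqP; split => // w /=; rewrite mul0r addr0 leNgt ta.
  move=> at_; rewrite (_ : [set w | _] = setT) ?probability_setT ?lee_fin 1?ltW//.
  by apply/seteqP; split => // w /=; rewrite mul0r addr0.
rewrite -quantile_affine//; last exact: has_inf_cdf.
congr (quantile _ tau); apply/funext => t; rewrite /cdf/= /distribution/pushforward.
congr (P _); apply/seteqP; split => w /=;
  by rewrite in_itv/= ler_pdivlMr// lerBrDl mulrC.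
Qed.

(** * Independence and product laws *)

(** Independence is agreement of the joint law with the product law on measurable rectangles, and
    these determine the product measure. *)
Lemma independent_product d (T : measurableType d) (R : realType)
    (P : probability T R) (X Y : {RV P >-> R}) (A : set (R * R)) :
  independent_RV X Y -> measurable A ->
  P [set w | A (X w, Y w)] = (distribution P X \x distribution P Y)%E A.
Proof.
move=> XY mA.
have mZ : measurable_fun setT (fun w => (X w, Y w)).
  by apply/measurable_fun_pair.
pose Z : {mfun T >-> (R * R)%type} := mfun_Sub (mem_set mZ).
apply/esym.
rewrite (@product_measure_unique _ _ _ _ _ _ _ (distribution P Z)) //.
Qed.

(** Both claims are moved to the product of the two laws. There Tonelli turns the integral of the
    absolute value into a product of two finite integrals, after which Fubini factors the signed
    integral. *)
Lemma independent_integrableM d (T : measurableType d) (R : realType)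
    (P : probability T R) (X Y : {RV P >-> R}) (f g : R -> R) :
  independent_RV X Y -> measurable_fun setT f -> measurable_fun setT g ->
  P.-integrable setT (fun w => (f (X w))%:E) ->
  P.-integrable setT (fun w => (g (Y w))%:E) ->
  P.-integrable setT (fun w => (f (X w) * g (Y w))%:E) /\
  (\int[P]_w (f (X w) * g (Y w))%:E
   = \int[P]_w (f (X w))%:E * \int[P]_w (g (Y w))%:E)%E.
Proof.
move=> XY mf mg if_ ig.
have mEf : measurable_fun setT (EFin \o f) by exact/measurable_EFinP.
have mEg : measurable_fun setT (EFin \o g) by exact/measurable_EFinP.
have mZ : measurable_fun setT (fun w => (X w, Y w)).
  exact/measurable_fun_pair.
pose Z : {mfun T >-> (R * R)%type} := mfun_Sub (mem_set mZ).
pose h (z : R * R) := (f z.1 * g z.2)%:E.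
have hE x y : h (x, y) = ((f x)%:E * (g y)%:E)%E by [].
have mh : measurable_fun setT h.
  apply/measurable_EFinP/measurable_funM; exact: measurableT_comp.
have ZE A : measurable A ->
    distribution P Z A = (distribution P X \x distribution P Y)%E A.
  by move=> mA; rewrite -independent_product.
have idf : (distribution P X).-integrable setT (EFin \o f).
  exact: integrable_pushforward.
have idg : (distribution P Y).-integrable setT (EFin \o g).
  exact: integrable_pushforward.
have ih : (distribution P X \x distribution P Y)%E.-integrable setT h.
  apply/integrable12ltyP => //.
  under eq_integral => x _.
    under eq_integral do rewrite hE abseM.
    rewrite ge0_integralZl//; last exact: measurableT_comp.
    over.
  rewrite /= ge0_integralZr//; last 2 first.
  - exact/measurable_EFinP/measurableT_comp.
  - exact: integral_ge0.
  have /integrableP[_ foo] := idf; have /integrableP[_ goo] := idg.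
  by apply: lte_mul_pinfty => //; [exact: integral_ge0|
    rewrite ge0_fin_numE//; exact: integral_ge0].
have iZ : P.-integrable setT (h \o Z).
  apply/integrableP; split; first exact: measurableT_comp.
  have /integrableP[_] := ih.
  rewrite -(@eq_measure_integral _ _ _ _ _ (distribution P Z)); last first.
    by move=> A mA _; exact: ZE.
  by rewrite ge0_integral_distribution//; exact: measurableT_comp.
split; first exact: iZ.
transitivity (\int[distribution P Z]_z h z)%E.
  by rewrite integral_distribution.
rewrite (eq_measure_integral (distribution P X \x distribution P Y)%E);
  last by move=> A mA _; exact: ZE.
rewrite -integral12_prod_meas1// /fubini_F.
under eq_integral => x _.
  under eq_integral do rewrite hE.
  rewrite integralZl//.
  over.
rewrite /= -(@integral_distribution _ _ _ _ _ _ Y (EFin \o g))//.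
rewrite -(@integral_distribution _ _ _ _ _ _ X (EFin \o f))//.
rewrite -(fineK (integrable_fin_num measurableT idg)).
by rewrite integralZr.
Qed.

(** * The conditional law of [Y] given [X] *)

(** Two integrable functions of [x] with equal integrals over every Borel set agree almost
    everywhere. Integrating either side over [A] gives the probability that [X] is in [A] and [Y] in
    [B]. *)
Lemma cond_distribution_ae d (T : measurableType d) (R : realType)
    (P : probability T R) (X Z Y : {RV P >-> R}) (f : R * R -> R)
    (kappa : R.-pker R ~> R) (B : set R) :
  independent_RV X Z -> measurable_fun setT f ->
  (forall w, Y w = f (X w, Z w)) -> is_cond_distribution X Y kappa ->
  measurable B ->
  {ae distribution P X, forall x, kappa x B = P [set w | B (f (x, Z w))]}.
Proof.
move=> XZ mf YE kappaP mB.
pose S := f @^-1` B.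
have mS : measurable S by rewrite -[S]setTI; exact: mf.
have SE x : P [set w | B (f (x, Z w))] = distribution P Z (xsection S x).
  by congr (P _); apply/seteqP; split => w /=; rewrite /xsection/= inE.
have mk : measurable_fun setT (kappa ^~ B) by exact: measurable_kernel.
suff : ae_eq (distribution P X) setT (kappa ^~ B)
    (fun x => distribution P Z (xsection S x)).
  by apply: filterS => x /(_ I); rewrite SE.
apply: integral_ae_eq => //.
- apply: (@le_integrable _ _ _ _ _ _ _ (cst 1%E)) => //.
  + move=> x _ /=; rewrite normr1 gee0_abs// -(@prob_kernel _ _ _ _ _ kappa x).
    by apply: le_measure; rewrite ?inE.
  + exact: finite_measure_integrable_cst.
- exact: measurable_fun_xsection.
move=> A _ mA; rewrite -kappaP//.
(* The event is that [(X, Z)] falls in the part of [S] above [A]. Its product measure is the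
   integral of the measures of its sections, which are those of [S] over [A] and empty elsewhere. *)
have mAS : measurable (A `*` setT `&` S).
  by apply: measurableI => //; exact: measurableX.
transitivity (P [set w | (A `*` setT `&` S) (X w, Z w)]).
  by congr (P _); apply/seteqP; split => w /=; rewrite YE => -[] // [].
rewrite independent_product// [RHS]integral_mkcond; apply: eq_integral => x _.
rewrite /= patchE; case: ifPn => [/set_mem|/negP] xA.
  congr (P (_ @^-1` _)).
  by apply/seteqP; split => y; rewrite /xsection/= !inE => //= -[].
rewrite (_ : xsection _ _ = set0) ?measure0//.
by apply/seteqP; split => // y; rewrite /xsection/= inE => -[[/= /mem_set]].
Qed.

Lemma cond_cdf_ae d (T : measurableType d) (R : realType)
    (P : probability T R) (X Z Y : {RV P >-> R}) (f : R * R -> R)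
    (kappa : R.-pker R ~> R) :
  independent_RV X Z -> measurable_fun setT f ->
  (forall w, Y w = f (X w, Z w)) -> is_cond_distribution X Y kappa ->
  {ae distribution P X, forall x t,
    kappa x `]-oo, t]%classic = P [set w | f (x, Z w) <= t]}.
Proof.
move=> XZ mf YE kappaP.
(* The exceptional null set depends on the ray, so only countably many rays are treated at once:
   rational endpoints, enumerated by [unpickle]. *)
have : {ae distribution P X, forall x (n : nat) q, unpickle n = Some q ->
    kappa x `]-oo, ratr q]%classic = P [set w | f (x, Z w) <= ratr q]}.
  apply/ae_foralln => n; case: (unpickle n) => [q|]; last exact: nearW.
  have := cond_distribution_ae XZ mf YE kappaP (measurable_itv `]-oo, ratr q]).
  by apply: filterS => x + _ [<-] => ->.
apply: filterS => x kq t.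
have mfx : measurable_fun setT (fun w => f (x, Z w)).
  by apply: measurableT_comp => //; exact/measurable_fun_pair.
pose fx : {RV P >-> R} := mfun_Sub (mem_set mfx).
(* kappa x carries no probability structure; normalizing it does nothing but
   provide one. *)
pose Q : probability R R := mnormalize (kappa x) (distribution P fx).
have QE A : Q A = kappa x A.
  by rewrite /Q/= /mnormalize prob_kernel onee_eq0/= invr1 mule1.
pose idR : {RV Q >-> R} := mfun_Sub (mem_set (@measurable_id _ R setT)).
rewrite -QE -[RHS]/(cdf fx t) -[LHS]/(cdf idR t).
apply: cdf_eq_rat => q.
rewrite -[LHS]/(Q _) QE; exact: (kq (pickle q) q (pickleK q)).
Qed.

Lemma cond_quantile_location_scale_ae d (T : measurableType d) (R : realType)
    (P : probability T R) (X eps Y : {RV P >-> R}) (m sigma : R -> R)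
    (kappa : R.-pker R ~> R) :
  measurable_fun setT m -> measurable_fun setT sigma ->
  (forall x, 0 <= sigma x) ->
  (forall w, Y w = m (X w) + sigma (X w) * eps w) ->
  independent_RV X eps -> is_cond_distribution X Y kappa ->
  {ae distribution P X, forall x tau, 0 < tau < 1 ->
    cond_quantile kappa x tau = m x + sigma x * quantile (cdf eps) tau}.
Proof.
move=> mm ms s0 YE indep kappaP.
have mf : measurable_fun setT (fun z : R * R => m z.1 + sigma z.1 * z.2).
  apply: measurable_funD; first exact: measurableT_comp.
  by apply: measurable_funM => //; exact: measurableT_comp.
have := cond_cdf_ae indep mf YE kappaP.
apply: filterS => x kx tau /andP[tau0 tau1].
rewrite -quantile_cdf_affine// /cond_quantile; congr (quantile _ tau).
exact/funext.
Qed.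

Lemma weighted_cond_quantile_ae d (T : measurableType d) (R : realType)
    (P : probability T R) (X eps Y : {RV P >-> R}) (m sigma J : R -> R)
    (kappa : R.-pker R ~> R) :
  measurable_fun setT m -> measurable_fun setT sigma ->
  (forall x, 0 <= sigma x) ->
  (forall w, Y w = m (X w) + sigma (X w) * eps w) ->
  independent_RV X eps -> is_cond_distribution X Y kappa ->
  lebesgue_measure.-integrable `[0, 1] (fun tau => (J tau)%:E) ->
  lebesgue_measure.-integrable `[0, 1]
    (fun tau => (J tau * quantile (cdf eps) tau)%:E) ->
  {ae distribution P X, forall x, weighted_cond_quantile kappa J x
    = m x * \int[lebesgue_measure]_(tau in `[0, 1]) J tau
      + sigma x * \int[lebesgue_measure]_(tau in `[0, 1])
          (J tau * quantile (cdf eps) tau)}.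
Proof.
move=> mm ms s0 YE indep kappaP iJ iJF.
have := cond_quantile_location_scale_ae mm ms s0 YE indep kappaP.
apply: filterS => x kx.
rewrite /weighted_cond_quantile -!RintegralZl// -RintegralD//; last 2 first.
- exact: (@integrableZl _ _ _ lebesgue_measure `[0, 1]%classic
    (measurable_itv _) (m x) _ iJ).
- exact: (@integrableZl _ _ _ lebesgue_measure `[0, 1]%classic
    (measurable_itv _) (sigma x) _ iJF).
rewrite /Rintegral; congr fine.
(* [kx] covers only 0 < tau < 1, so the two endpoints are discarded as a null set. *)
apply: (@integral_eq_off_null _ _ _ lebesgue_measure _ ([set 0; 1] : set R)).
- by apply: measurableU.
- by apply: countable_lebesgue_measure0; exact/finite_set_countable.
move=> tau /set_mem[]; rewrite /= in_itv/= => /andP[t0 t1] /not_orP[/eqP n0 /eqP n1].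
rewrite kx; last by rewrite !lt_neqAle t0 t1 n1 eq_sym n0.
congr EFin; ring.
Qed.

(** * Integrability from finite moments, and transfer from the law of [X] *)

(** A difference of extended reals is finite only when both terms are, since +oo - +oo is given an
    infinite value. This extracts integrability of [eps] and its square from the values of [Eeps]
    and [Veps]. *)
Lemma integral_fin_num_integrable d (T : measurableType d) (R : realType)
    (mu : {measure set T -> \bar R}) (f : T -> \bar R) :
  measurable_fun setT f -> (\int[mu]_x f x)%E \is a fin_num ->
  mu.-integrable setT f.
Proof.
move=> mf; rewrite integralE fin_numB => /andP[fp fn].
apply/integrableP; split => //.
have -> : (\int[mu]_x `|f x| = \int[mu]_x (f^\+ x + f^\- x))%E.
  by apply: eq_integral => x _; rewrite -/((abse \o f) x) fune_abse.
rewrite ge0_integralD//; last 2 first.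
- exact: measurable_funepos.
- exact: measurable_funeneg.
by rewrite lte_add_pinfty// ltey_eq ?fp ?fn.
Qed.

Lemma ae_distribution d (T : measurableType d) (R : realType)
    (P : probability T R) (X : {RV P >-> R}) (Q : R -> Prop) :
  {ae distribution P X, forall x, Q x} -> {ae P, forall w, Q (X w)}.
Proof.
move=> [N [mN N0 QN]]; exists (X @^-1` N); split => //.
  by rewrite -[_ @^-1` _]setTI; exact: measurable_funP.
by move=> w /QN.
Qed.

(** * The two identities *)

Theorem lemma2 (R : realType) (d : measure_display) (T : measurableType d)
  (P : probability T R) (X eps Y : {RV P >-> R}) (m sigma J W : R -> R)
  (kappa : R.-pker R ~> R)
  (mm : measurable_fun setT m) (msigma : measurable_fun setT sigma)
  (sigma_ge0 : forall x, 0 <= sigma x)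
  (YE : forall w, Y w = m (X w) + sigma (X w) * eps w)
  (indep : independent_RV X eps)
  (Eeps : ('E_P[eps] = 0)%E) (Veps : ('V_P[eps] = 1)%E)
  (kappaP : is_cond_distribution X Y kappa)
  (mW : measurable_fun setT W)
  (iJ : lebesgue_measure.-integrable `[0, 1] (fun tau => (J tau)%:E))
  (iJF : lebesgue_measure.-integrable `[0, 1]
           (fun tau => (J tau * quantile (cdf eps) tau)%:E))
  (iWm : P.-integrable setT (fun w => (W (X w) * m (X w))%:E))
  (iWs : P.-integrable setT (fun w => (W (X w) * sigma (X w))%:E))
  (iWm2 : P.-integrable setT (fun w => (W (X w) * m (X w) ^+ 2)%:E))
  (iWs2 : P.-integrable setT (fun w => (W (X w) * sigma (X w) ^+ 2)%:E))
  (EWs_gt0 : (0 < 'E_P[fun w => (W (X w) * sigma (X w))%R])%E) :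
  (\int[lebesgue_measure]_(tau in `[0, 1]) J tau = 1 ->
   ('E_P[fun w => (W (X w) * sigma (X w))%R]
      * (\int[lebesgue_measure]_(tau in `[0, 1])
           (J tau * quantile (cdf eps) tau))%R%:E
    = 'E_P[fun w =>
        (W (X w) * (weighted_cond_quantile kappa J (X w) - Y w))%R])%E)
  /\
  (\int[lebesgue_measure]_(tau in `[0, 1]) J tau = 0 ->
   ('E_P[fun w => (W (X w) * weighted_cond_quantile kappa J (X w) ^+ 2)%R]
    = ((\int[lebesgue_measure]_(tau in `[0, 1])
          (J tau * quantile (cdf eps) tau)) ^+ 2)%R%:E
      * 'E_P[fun w => (W (X w) * (Y w ^+ 2 - m (X w) ^+ 2))%R])%E).
Proof.
set c := \int[_]_(_ in _) (_ * quantile _ _).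
have ieps : P.-integrable setT (EFin \o eps).
  apply: integral_fin_num_integrable; first exact/measurable_EFinP.
  by move: Eeps; rewrite unlock /= => ->.
have Ieps : (\int[P]_w (eps w)%:E = 0)%E by rewrite -expectation_def.
have Ieps2 : (\int[P]_w (eps w ^+ 2)%:E = 1)%E.
  rewrite -Veps /variance covariance.unlock Eeps expectation.unlock.
  by apply: eq_integral => w _; rewrite !fctE /= subr0 expr2.
have ieps2 : P.-integrable setT (fun w => (eps w ^+ 2)%:E).
  apply: integral_fin_num_integrable; last by rewrite Ieps2.
  by apply/measurable_EFinP/measurable_funX.
have [N [mN N0 rN]] := ae_distribution
  (weighted_cond_quantile_ae mm msigma sigma_ge0 YE indep kappaP iJ iJF).
have rE w : w \in [set: T] `\` N -> weighted_cond_quantile kappa J (X w)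
    = m (X w) * \int[lebesgue_measure]_(tau in `[0, 1]) J tau
      + sigma (X w) * c.
  by move=> /set_mem[_ Nw]; apply: contrapT => /rN.
have mWs : measurable_fun setT (fun x => W x * sigma x).
  exact: measurable_funM.
have mWs2 : measurable_fun setT (fun x => W x * sigma x ^+ 2).
  by apply: measurable_funM => //; exact: measurable_funX.
have mid : measurable_fun setT (fun e : R => e) by exact: measurable_id.
have [iWse EWse] := independent_integrableM indep mWs mid iWs ieps.
split=> J_.
  rewrite unlock; apply/esym.
  (* With total weight 1 the terms in [m] cancel, and off [N] the difference r - Y is sigma * (c -
     eps). *)
  rewrite (integral_eq_off_null
    (g := fun w => (c%:E * (W (X w) * sigma (X w))%:E
                    - (W (X w) * sigma (X w) * eps w)%:E)%E) mN N0); last first.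
    move=> w /rE ->; rewrite J_ YE -EFinM -EFinB; congr EFin; ring.
  rewrite integralB//; last exact: integrableZl.
  by rewrite integralZl// EWse Ieps mule0 sube0 muleC.
have mWms : measurable_fun setT (fun x => W x * m x * sigma x).
  by do 2 apply: measurable_funM => //.
have iWms : P.-integrable setT (fun w => (W (X w) * m (X w) * sigma (X w))%:E).
  have := integrableD measurableT (integrable_abse iWm2) (integrable_abse iWs2).
  apply: le_integrable => //.
    exact/measurable_EFinP/(measurableT_comp mWms).
  move=> w _; rewrite /= lee_fin [leRHS]ger0_norm ?addr_ge0//.
  rewrite -mulrA !normrM -mulrDr ler_wpM2l//.
  have := sqr_ge0 (`|m (X w)| - `|sigma (X w)|).
  have := sqr_ge0 `|m (X w)|; have := sqr_ge0 `|sigma (X w)|; nra.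
have msqr : measurable_fun setT (fun e : R => e ^+ 2) by exact: measurable_funX.
have [iWmse EWmse] := independent_integrableM indep mWms mid iWms ieps.
have [iWs2e EWs2e] := independent_integrableM indep mWs2 msqr iWs2 ieps2.
rewrite unlock.
(* With total weight 0, r reduces to sigma * c off [N]. *)
rewrite (integral_eq_off_null
  (g := fun w => ((c ^+ 2)%:E * (W (X w) * sigma (X w) ^+ 2)%:E)%E) mN N0);
  last first.
  by move=> w /rE ->; rewrite J_ -EFinM; congr EFin; ring.
rewrite integralZl//; congr (_ * _)%E.
(* Each term is a function of [X] times a function of [eps]: the cross term vanishes since [eps] has
   mean 0, and the square term keeps only W * sigma^2 since [eps] has second moment 1. *)
transitivity (\int[P]_w (2%:E * (W (X w) * m (X w) * sigma (X w) * eps w)%:E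
  + (W (X w) * sigma (X w) ^+ 2 * eps w ^+ 2)%:E))%E; last first.
  by apply: eq_integral => w _; rewrite YE -EFinM -EFinD; congr EFin; ring.
rewrite integralD//; last exact: integrableZl.
by rewrite integralZl// EWmse EWs2e Ieps Ieps2 !mule0 add0e mule1.
Qed.
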